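(* Let $F$ be an algebraically closed field of characteristic $0$, let $n\ge2$, $\Omega=\{1,\dots,n\}$, and let $\mathfrak{A}$ be the universal associative envelope of the anti-Jordan triple system of all $n\times n$ matrices over $F$, with generators $e_{i,j}$. For all $i,j,k,\ell\in\Omega$ with $\ell\ne1$ the following identities hold in $\mathfrak{A}$. (1) $$\begin{aligned}e_{1,k}e_{1,1}e_{\ell,1}\cdot e_{i,j}=\delta_{j,\ell}\Big[&\tfrac12\Big\{\big(\delta_{k,1}\widehat\delta_{j,1}\delta_{i,1}+\widehat\delta_{i,1}\delta_{i,k}\big)e_{1,1}^4+\big(\widehat\delta_{i,1}\delta_{i,k}-\delta_{k,1}\widehat\delta_{j,1}\delta_{i,1}\big)e_{1,1}^2\Big\}\\&-\widehat\delta_{i,1}\delta_{k,1}e_{1,1}e_{i,1}-\widehat\delta_{k,1}e_{1,k}e_{i,1}\Big].\end{aligned}$$ (2) If $(i,j)\ne(1,1)$: $$\begin{aligned}e_{1,k}e_{1,1}e_{\ell,1}\cdot e_{1,i}e_{j,1}=\delta_{i,\ell}\Big[&\delta_{k,1}\Big(\delta_{j,1}\tfrac12(e_{1,1}-e_{1,1}^3)-\widehat\delta_{j,1}e_{1,1}^2e_{j,1}\Big)\\&-\widehat\delta_{k,1}\Big(\widehat\delta_{j,1}e_{1,k}e_{1,1}e_{j,1}+\delta_{j,1}(e_{1,1}^2e_{1,k}-e_{1,k})\Big)\Big].\end{aligned}$$ (3) If $j\ne1$: $\;e_{1,i}e_{1,1}e_{j,1}\cdot e_{1,k}e_{1,1}e_{\ell,1}=\delta_{j,k}\Big(e_{1,i}e_{\ell,1}-\widehat\delta_{i,1}\delta_{i,\ell}\tfrac12(e_{1,1}^4+e_{1,1}^2)\Big).$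 (4) $e_{1,k}e_{1,1}e_{\ell,1}\cdot e_{i,1}e_{1,j}=0,\quad e_{1,k}e_{1,1}e_{\ell,1}\cdot e_{1,1}^2e_{1,j}=0,\quad e_{1,k}e_{1,1}e_{\ell,1}\cdot e_{1,1}^4=0.$
   Context: $\delta_{i,j}$ is the Kronecker delta and $\widehat\delta_{i,j}=1-\delta_{i,j}$. The anti-Jordan triple system of all $n\times n$ matrices over $F$ has trilinear product $\langle a,b,c\rangle=abc-cba$. Its universal associative envelope is $\mathfrak{A}=F\langle X\rangle/I$, where $F\langle X\rangle$ is the free unital associative algebra on symbols $X=\{e_{i,j}\}_{i,j\in\Omega}$ (with $e_{i,j}$ corresponding to the matrix unit $E_{i,j}$), and $I$ is the two-sided ideal generated by all elements $e_{i,j}e_{k,\ell}e_{m,t}-e_{m,t}e_{k,\ell}e_{i,j}-\delta_{j,k}\delta_{\ell,m}e_{i,t}+\delta_{t,k}\delta_{\ell,i}e_{m,j}$ for $i,j,k,\ell,m,t\in\Omega$. The image of $e_{i,j}$ in $\mathfrak{A}$ is again denoted $e_{i,j}$. *)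

(* Defs.v *)
From HB Require Import structures.
From mathcomp Require Import all_boot all_order all_algebra.
From mathcomp Require Import boolp monalg.

Set Implicit Arguments.
Unset Strict Implicit.
Unset Printing Implicit Defensive.

Import GRing.Theory.
Local Open Scope ring_scope.
Local Open Scope quotient_scope.

Section TwoSidedIdeal.
Variables (F : pzRingType) (A : algType F) (G : A -> Prop).

Inductive ideal_span : A -> Prop :=
| ideal_span_gen x : G x -> ideal_span x
| ideal_span0 : ideal_span 0
| ideal_spanD x y : ideal_span x -> ideal_span y -> ideal_span (x + y)
| ideal_spanMl a x : ideal_span x -> ideal_span (a * x)
| ideal_spanMr a x : ideal_span x -> ideal_span (x * a).

Definition gen_ideal : pred A := fun x => `[< ideal_span x >].

Lemma gen_idealP x : reflect (ideal_span x) (x \in gen_ideal).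
Proof. exact: asboolP. Qed.

Fact gen_ideal_zmod_closed : zmod_closed gen_ideal.
Proof.
split=> [|x y /gen_idealP Ix /gen_idealP Iy]; apply/gen_idealP.
  exact: ideal_span0.
by apply: ideal_spanD => //; rewrite -mulN1r; apply: ideal_spanMl.
Qed.

HB.instance Definition _ :=
  GRing.isZmodClosed.Build A gen_ideal gen_ideal_zmod_closed.

(* The ring_quotient library puts a ring structure on quotients of commutative
   rings by proper ideals only.  Here [gen_ideal] may be the whole of [A], so
   the quotient algebra is built over the possibly zero rings. *)
Definition quot_alg := Quotient.quot (GRing.ZmodClosed.clone A gen_ideal _).
HB.instance Definition _ := GRing.Zmodule.on quot_alg.

Definition quot_pi (x : A) : quot_alg := \pi_(Quotient.quot (GRing.ZmodClosed.clone A gen_ideal _)) x.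

Lemma quot_piP x y : quot_pi x = quot_pi y <-> ideal_span (x - y).
Proof.
rewrite /quot_pi; split=> [/eqP|/gen_idealP Ixy].
  by rewrite -Quotient.idealrBE => /gen_idealP.
by apply/eqP; rewrite -Quotient.idealrBE.
Qed.

Lemma quot_pi_surj (u : quot_alg) : {x | quot_pi x = u}.
Proof. by exists (repr (u : Quotient.quot (GRing.ZmodClosed.clone A gen_ideal _))); apply: reprK. Qed.

Lemma quot_piD x y : quot_pi (x + y) = quot_pi x + quot_pi y.
Proof. exact: Quotient.pi_add. Qed.

Definition quot_repr (u : quot_alg) : A := sval (quot_pi_surj u).

Lemma quot_reprK u : quot_pi (quot_repr u) = u.
Proof. exact: (svalP (quot_pi_surj u)). Qed.

Definition quot_one : quot_alg := quot_pi 1.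
Definition quot_mul (u v : quot_alg) := quot_pi (quot_repr u * quot_repr v).
Definition quot_scale (c : F) (u : quot_alg) := quot_pi (c *: quot_repr u).

Lemma quot_piM x y : quot_pi (x * y) = quot_mul (quot_pi x) (quot_pi y).
Proof.
set u := quot_pi x; set v := quot_pi y; apply/quot_piP.
have -> : x * y - quot_repr u * quot_repr v =
  (x - quot_repr u) * y + quot_repr u * (y - quot_repr v).
  by rewrite mulrBl mulrBr addrA subrK.
by apply: ideal_spanD; [apply: ideal_spanMr|apply: ideal_spanMl];
  apply/quot_piP; rewrite quot_reprK.
Qed.

Lemma quot_piZ c x : quot_pi (c *: x) = quot_scale c (quot_pi x).
Proof.
apply/quot_piP; rewrite -scalerBr -[x - _]mul1r scalerAl.
by apply: ideal_spanMl; apply/quot_piP; rewrite quot_reprK.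
Qed.

Fact quot_mulA : associative quot_mul.
Proof.
move=> u v w; rewrite -[u]quot_reprK -[v]quot_reprK -[w]quot_reprK.
by rewrite -!quot_piM mulrA.
Qed.

Fact quot_mul1 : left_id quot_one quot_mul.
Proof. by move=> u; rewrite -[u]quot_reprK -quot_piM mul1r. Qed.

Fact quot_mulr1 : right_id quot_one quot_mul.
Proof. by move=> u; rewrite -[u]quot_reprK -quot_piM mulr1. Qed.

Fact quot_mulDl : left_distributive quot_mul +%R.
Proof.
move=> u v w; rewrite -[u]quot_reprK -[v]quot_reprK -[w]quot_reprK.
by rewrite -!(quot_piM, quot_piD) mulrDl.
Qed.

Fact quot_mulDr : right_distributive quot_mul +%R.
Proof.
move=> u v w; rewrite -[u]quot_reprK -[v]quot_reprK -[w]quot_reprK.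
by rewrite -!(quot_piM, quot_piD) mulrDr.
Qed.

HB.instance Definition _ := GRing.Zmodule_isPzRing.Build quot_alg
  quot_mulA quot_mul1 quot_mulr1 quot_mulDl quot_mulDr.

Fact quot_scaleA a b u : quot_scale a (quot_scale b u) = quot_scale (a * b) u.
Proof. by rewrite -[u]quot_reprK -!quot_piZ scalerA. Qed.

Fact quot_scale1 : left_id 1 quot_scale.
Proof. by move=> u; rewrite -[u]quot_reprK -quot_piZ scale1r. Qed.

Fact quot_scaleDr : right_distributive quot_scale +%R.
Proof.
move=> c u v; rewrite -[u]quot_reprK -[v]quot_reprK.
by rewrite -!(quot_piZ, quot_piD) scalerDr.
Qed.

Fact quot_scaleDl u : {morph quot_scale^~ u : a b / a + b}.
Proof.
by move=> a b; rewrite -[u]quot_reprK -!(quot_piZ, quot_piD) scalerDl.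
Qed.

HB.instance Definition _ := GRing.Zmodule_isLmodule.Build F quot_alg
  quot_scaleA quot_scale1 quot_scaleDr quot_scaleDl.

Fact quot_scaleAl (c : F) (u v : quot_alg) : c *: (u * v) = (c *: u) * v.
Proof.
rewrite -[u]quot_reprK -[v]quot_reprK.
rewrite -[LHS]/(quot_scale c (quot_mul _ _)).
by rewrite -[RHS]/(quot_mul (quot_scale _ _) _) -!(quot_piM, quot_piZ) scalerAl.
Qed.

Fact quot_scaleAr (c : F) (u v : quot_alg) : c *: (u * v) = u * (c *: v).
Proof.
rewrite -[u]quot_reprK -[v]quot_reprK.
rewrite -[LHS]/(quot_scale c (quot_mul _ _)).
by rewrite -[RHS]/(quot_mul _ (quot_scale _ _)) -!(quot_piM, quot_piZ) scalerAr.
Qed.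

Fact quot_pi_zmod_morphism : zmod_morphism quot_pi.
Proof. move=> x y; rewrite quot_piD -scaleN1r quot_piZ -[LHS]/(_ + -1 *: _).
by rewrite scaleN1r. Qed.

HB.instance Definition _ :=
  GRing.isZmodMorphism.Build A quot_alg quot_pi quot_pi_zmod_morphism.

Fact quot_pi_monoid_morphism : monoid_morphism quot_pi.
Proof. by split=> // x y; apply: quot_piM. Qed.

HB.instance Definition _ :=
  GRing.isMonoidMorphism.Build A quot_alg quot_pi quot_pi_monoid_morphism.

Fact quot_pi_scalable : scalable quot_pi.
Proof. by move=> c x; apply: quot_piZ. Qed.

HB.instance Definition _ :=
  GRing.isScalable.Build F A quot_alg *:%R quot_pi quot_pi_scalable.

Lemma quot_pi_triple (a b c u v : A) (r s : F) :
    ideal_span (a * b * c - c * b * a - r *: u + s *: v) ->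
  quot_pi a * quot_pi b * quot_pi c - quot_pi c * quot_pi b * quot_pi a =
  r *: quot_pi u - s *: quot_pi v.
Proof.
rewrite -[X in ideal_span X]subr0 => /quot_piP.
rewrite raddf0 raddfD !raddfB /= !rmorphM /= !linearZZ.
by move/eqP; rewrite /= !scalerN -addrA addr_eq0 opprD opprK => /eqP.
Qed.

End TwoSidedIdeal.

Section FreeAlgebra.
Variables (F : comNzRingType) (X : choiceType).

(* The monoid algebra of the free monoid on [X]. *)
Definition free_alg := {malg F[{fmonom X}]}.
HB.instance Definition _ := GRing.Lalgebra.on free_alg.

Fact free_alg_scalerAr (c : F) (u v : free_alg) : c *: (u * v) = u * (c *: v).
Proof.
suff cC (w : free_alg) : w * c%:MP = c%:MP * w.
  by rewrite -[LHS]mul_malgC -[c *: v]mul_malgC mulrA -cC -mulrA.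
rewrite mul_malgC malgM_def malgZ_def fgmulgU.
by apply: eq_bigr => m _; rewrite mulm1 mulrC.
Qed.

HB.instance Definition _ :=
  GRing.Lalgebra_isAlgebra.Build F free_alg free_alg_scalerAr.

Definition free_gen (x : X) : free_alg := << fmu x >>.

End FreeAlgebra.

Definition kron (F : pzRingType) (T : eqType) (i j : T) : F := (i == j)%:R.
Definition kronC (F : pzRingType) (T : eqType) (i j : T) : F := 1 - kron F i j.

Definition ajt_prod (F : pzRingType) n (a b c : 'M[F]_n) : 'M[F]_n :=
  a *m b *m c - c *m b *m a.

Section Envelope.
Variables (F : fieldType) (n : nat).
Local Notation d := (kron F).
Local Notation x i j := (free_gen F (i, j)).

Definition ajts_rel (i j k l m t : 'I_n) : free_alg F ('I_n * 'I_n)%type :=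
  x i j * x k l * x m t - x m t * x k l * x i j
  - (d j k * d l m) *: x i t + (d t k * d l i) *: x m j.

(* Killing [ajts_rel] makes [abc - cba], for generators [a], [b] and [c], equal
   to the triple product of the corresponding matrix units, which is: *)
Lemma ajt_prod_delta (i j k l m t : 'I_n) :
  ajt_prod (delta_mx i j) (delta_mx k l) (delta_mx m t) =
  (d j k * d l m) *: delta_mx i t - (d t k * d l i) *: delta_mx m j :> 'M[F]_n.
Proof.
have E (a b c e f g : 'I_n) : delta_mx a b *m delta_mx c e *m delta_mx f g =
    (d b c * d e f) *: delta_mx a g :> 'M[F]_n.
  rewrite mul_delta_mx_cond /kron.
  case: (b == c); last by rewrite mulr0n mul0mx mul0r scale0r.
  by rewrite mulr1n mul_delta_mx_cond mul1r scaler_nat.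
by rewrite /ajt_prod !E.
Qed.

Definition is_ajts_rel u : Prop :=
  exists i j k l m t, u = ajts_rel i j k l m t.

Definition ajts_env := quot_alg is_ajts_rel.
HB.instance Definition _ := GRing.PzRing.on ajts_env.
HB.instance Definition _ := GRing.Lmodule.on ajts_env.

Fact ajts_env_oner_neq0 : (1 : ajts_env) != 0.
Proof.
have triple0 (A : algType F) (f : A -> F) :
    (forall u v, f (u + v) = f u + f v) -> (forall u, f (- u) = - f u) ->
    (forall r u, f (r *: u) = r * f u) -> (forall u v, f (u * v) = f u * f v) ->
  forall a b c u v r s, f a = 0 -> f c = 0 -> f u = 0 -> f v = 0 ->
    f (a * b * c - c * b * a - r *: u + s *: v) = 0.
  move=> fD fN fZ fM a b c u v r s fa fc fu fv.
  by rewrite !(fD, fN, fZ, fM) fa fc fu fv !(mulr0, subr0, addr0).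
pose e : free_alg F ('I_n * 'I_n)%type -> F := mcoeff mone.
have ex p : e (free_gen F p) = 0.
  by rewrite /e mcoeffU; case: eqP => // /(congr1 val); rewrite /= fmuE fm1.
have eD u v : e (u + v) = e u + e v by apply: mcoeffD.
have eN u : e (- u) = - e u by apply: mcoeffN.
have eZ c u : e (c *: u) = c * e u by apply: mcoeffZ.
have eM u v : e (u * v) = e u * e v by apply: rmorphM.
suff Ie u : ideal_span is_ajts_rel u -> e u = 0.
  apply/eqP => e10; have /Ie/eqP : ideal_span is_ajts_rel 1.
    by rewrite -[1]subr0; apply/quot_piP; rewrite raddf0.
  by rewrite [e 1]rmorph1 oner_eq0.
elim=> {u} [_ [i [j [k [l [m [t ->]]]]]]||u v _ u0 _ v0|a u _ u0|a u _ u0].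
- have T := triple0 _ e eD eN eZ eM (x i j) (x k l) (x m t) (x i t) (x m j).
  exact: (T _ _ (ex _) (ex _) (ex _) (ex _)).
- exact: mcoeff0.
- by rewrite eD u0 v0 addr0.
- by rewrite eM u0 mulr0.
- by rewrite eM u0 mul0r.
Qed.

HB.instance Definition _ :=
  GRing.PzSemiRing_isNonZero.Build ajts_env ajts_env_oner_neq0.
HB.instance Definition _ :=
  GRing.LSemiModule_isLSemiAlgebra.Build F ajts_env (@quot_scaleAl _ _ _).
HB.instance Definition _ :=
  GRing.LSemiAlgebra_isSemiAlgebra.Build F ajts_env (@quot_scaleAr _ _ _).

Definition env_gen (i j : 'I_n) : ajts_env := quot_pi is_ajts_rel (x i j).

Lemma env_gen_rel (i j k l m t : 'I_n) (e := env_gen) :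
  e i j * e k l * e m t - e m t * e k l * e i j =
  (d j k * d l m) *: e i t - (d t k * d l i) *: e m j.
Proof.
have I : ideal_span is_ajts_rel (ajts_rel i j k l m t).
  by apply: ideal_span_gen; exists i, j, k, l, m, t.
exact: (quot_pi_triple I).
Qed.

End Envelope.

(* Main.v *)
From HB Require Import structures.
Require Import Defs.
From mathcomp Require Import ssrAC all_boot all_order all_algebra.

Set Implicit Arguments.
Unset Strict Implicit.
Unset Printing Implicit Defensive.

Import GRing.Theory.
Local Open Scope ring_scope.

(**
The envelope is the universal target of linear maps E from n x n matrices to an
algebra such that E a E b E c - E c E b E a = E (abc - cba).  When
n > 1, over an algebraically closed field of characteristic 0, the irreducible
ones are, besides E = 0, the maps
x |-> l x with l = 1, -1 and the maps x |-> l x^T with l = i, -i: reversing the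
order of the factors changes the sign of abc - cba, and l ^+ 3 = - l restores
it.  Checking an identity on these maps is a computation with matrix units, but
it settles the identity in the envelope only if nothing else happens there.
The proof therefore finds this decomposition inside an arbitrary target.

The key is u = E 1, which in the models above is the scalar l, so that its
square v = u * u separates the two families (v = 1 and v = -1).
- The triples (1, 1, a) show that v commutes with every E a, and (a, b, 1) that
  E a E b u = u E b E a + E [a, b].  Pulling u through E a E b twice then gives
  [u, E [a, b]] = 0.  Matrices are spanned by commutators and 1, so u is
  central ([unit_central]).
- Centrality turns the relation above into u [E a, E b] = E [a, b].  The
  anticommutator of [E a, E b] and E c is a difference of two triple products,
  so u (E x E c + E c E x) = v E (xc + cx) when x = [a, b], hence always.
  Adding both, 2 u E x E y = (v + 1) E (xy) + (v - 1) E (yx) ([unit_mul2]).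
- For x = E_ii, y = E_ij with i != j this forces v v E y = E y; a triple
  product of matrix units reaches the E_ii, so v v E = E ([unit_pow4_mul]).

Thus (1 + v) / 2 and (1 - v) / 2 act on the image of E as complementary
projections, and E x E y = S (xy) + R (yx), where S = u (1 + v) / 2 E
([straight]) and R = u (1 - v) / 2 E ([reversed]); moreover v S = S, v R = - R,
S x E y = u S (xy) and R x E y = u R (yx).  These rules evaluate every word in
the generators.  In particular, if m != 1 then e_1k e_11 e_m1 = u R (E_mk), as
its straight part vanishes, and the identities compare coefficients of the
straight and reversed images of matrix units.
*)

(** * Induction on matrices *)

Section CommutatorInduction.
Variables (F : fieldType) (charF : [pchar F] =i pred0) (n : nat).
Implicit Types (x a b : 'M[F]_n) (i j : 'I_n).

Lemma delta_mx_ind (P : 'M[F]_n -> Prop) :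
    P 0 -> (forall c a b, P a -> P b -> P (c *: a + b)) ->
    (forall i j, P (delta_mx i j)) ->
  forall x, P x.
Proof.
move=> P0 PL Pd x; rewrite (matrix_sum_delta x).
have PS (I : finType) (G : I -> 'M[F]_n) :
    (forall t, P (G t)) -> P (\sum_t G t).
  move=> PG; apply: big_ind => // a b Pa Pb.
  by rewrite -[a]scale1r; apply: PL.
by apply: (PS) => i; apply: (PS) => j; rewrite -[_ *: _]addr0; apply: PL.
Qed.

(** In characteristic 0 the trace-zero matrices, which are sums of commutators,
    and the identity span all matrices. *)
Lemma commutator_mx_ind (P : 'M[F]_n -> Prop) :
    P 1%:M -> (forall c a b, P a -> P b -> P (c *: a + b)) ->
    (forall a b, P (a *m b - b *m a)) ->
  forall x, P x.
Proof.
move=> P1 PL Pc.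
have P0 : P 0 by rewrite -(subrr ((0 : 'M[F]_n) *m 0)); apply: Pc.
have PD a b : P a -> P b -> P (a + b) by rewrite -{2}[a]scale1r; apply: PL.
apply: delta_mx_ind => // i j.
have [<-{j}|/negPf neij] := eqVneq i j; last first.
  suff -> : delta_mx i j = delta_mx i i *m delta_mx i j
      - delta_mx i j *m delta_mx i i :> 'M[F]_n by [].
  by rewrite !mul_delta_mx_cond eqxx eq_sym neij subr0.
have nF : n%:R != 0 :> F.
  by rewrite ((pcharf0P F).1 charF) -lt0n (leq_trans _ (ltn_ord i)).
have Pn : P (n%:R *: delta_mx i i).
  (* Summing E_ii - E_jj = [E_ij, E_ji] over j gives n E_ii - 1. *)
  have -> : n%:R *: delta_mx i i =
      \sum_j (delta_mx i j *m delta_mx j i - delta_mx j i *m delta_mx i j)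
      + 1%:M :> 'M[F]_n.
    rewrite scaler_nat -[in X in _ *+ X](card_ord n) -sumr_const.
    rewrite mx1_sum_delta -big_split /=.
    by apply: eq_bigr => j _; rewrite !mul_delta_mx subrK.
  by apply: (PD) => //; apply: big_ind => // j _; apply: Pc.
rewrite -[delta_mx i i](scalerK nF) -[_ *: _]addr0; exact: PL.
Qed.

End CommutatorInduction.

(** * The image of the identity matrix *)

Section TripleRepresentation.
Variables (F : fieldType) (charF : [pchar F] =i pred0).
Variables (n : nat) (n_ge2 : (2 <= n)%N) (A : algType F).
Variable E : {linear 'M[F]_n -> A}.
Hypothesis E_triple : forall a b c,
  E a * E b * E c - E c * E b * E a = E (ajt_prod a b c).
Implicit Types (x y a b c : 'M[F]_n) (i j : 'I_n).

Local Notation u := (E 1%:M).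
Local Notation h := (2^-1 : F).

Lemma half_double (V : lmodType F) (w : V) : h *: (w + w) = w.
Proof.
have F2 : 2 != 0 :> F by rewrite ((pcharf0P F).1 charF).
by rewrite -mulr2n -scaler_nat scalerA mulVf // scale1r.
Qed.

Lemma sqr_unit_central a : u * u * E a = E a * u * u.
Proof.
apply/eqP; rewrite -subr_eq0 E_triple /ajt_prod !mul1mx !mulmx1 subrr.
by rewrite raddf0.
Qed.

Lemma mul_unit_rev a b :
  E a * E b * u = u * E b * E a + E (a *m b - b *m a).
Proof.
by apply/eqP; rewrite addrC -subr_eq E_triple /ajt_prod mul1mx mulmx1.
Qed.

(** Moving u through E a E b twice by [mul_unit_rev], and once by the
    centrality of u * u, makes u commute with E of commutators. *)
Lemma unit_central a : u * E a = E a * u.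
Proof.
move: a; apply: (commutator_mx_ind charF) => // [c a b ua ub|a b].
  by rewrite linearP mulrDl mulrDr -scalerAl -scalerAr ua ub.
have: E a * E b * u * u = u * u * E a * E b.
  rewrite sqr_unit_central -!mulrA [u * (u * _)]mulrA.
  by rewrite sqr_unit_central !mulrA.
rewrite mul_unit_rev mulrDl -!mulrA [E b * _]mulrA mul_unit_rev mulrDr.
rewrite !mulrA -opprB raddfN mulrN -addrA => /eqP.
by rewrite addrC -subr_eq0 addrK addrC subr_eq0 => /eqP.
Qed.

Lemma unit_commutator a b :
  u * (E a * E b - E b * E a) = E (a *m b - b *m a).
Proof.
apply/eqP; rewrite mulrBr subr_eq mulrA unit_central -mulrA unit_central mulrA.
by rewrite mul_unit_rev addrC mulrA.
Qed.

(** For x = ab - ba the sum xc + cx is the difference of the triple products of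
    (a, b, c) and (b, a, c), and u (E a E b - E b E a) = E x.  Commutators and 1
    then suffice by linearity. *)
Lemma unit_anticommutator x c :
  u * (E x * E c + E c * E x) = u * u * E (x *m c + c *m x).
Proof.
(* Applied both to the matrices and to their images. *)
have exch (V : zmodType) (p q r s : V) : p - q + (r - s) = p - s - (q - r).
  by rewrite opprB (AC (2*2) ((1*4)*(3*2))).
move: x; apply: (commutator_mx_ind charF) => [|t a b Ha Hb|a b].
- by rewrite mulmx1 mul1mx raddfD -unit_central mulrDr mulrA -mulrDr.
- rewrite linearP mulrDl [E c * _]mulrDr -scalerAl -scalerAr addrACA.
  rewrite -scalerDr mulrDr.
  rewrite -scalerAr Ha Hb mulmxDl mulmxDr -scalemxAl -scalemxAr addrACA.
  by rewrite -scalerDr linearP mulrDr -scalerAr.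
have -> : (a *m b - b *m a) *m c + c *m (a *m b - b *m a) =
    ajt_prod a b c - ajt_prod b a c.
  by rewrite mulmxBl mulmxBr exch /ajt_prod !mulmxA.
rewrite [in RHS]raddfB /= -!E_triple -exch -unit_commutator.
rewrite [E c * _]mulrA -unit_central -!mulrA -mulrDr; do 2!congr (_ * _).
by rewrite mulrBl mulrBr !mulrA.
Qed.

(** The sum of the commutator and anticommutator formulas; the left side stands
    for 2 u E x E y. *)
Lemma unit_mul2 x y :
  u * (E x * E y) + u * (E x * E y) =
  (u * u * E (x *m y) + E (x *m y)) + (u * u * E (y *m x) - E (y *m x)).
Proof.
rewrite [RHS]addrACA -[in RHS]mulrDr -linearD -linearB -unit_commutator.
by rewrite -unit_anticommutator -[RHS]mulrDr addrACA subrr addr0 mulrDr.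
Qed.

(** The model is x = E_ii, y = E_ij.  With v = u * u and W = u E x E y,
    [unit_mul2] reads u E x E x = v E x and 2 W = (v + 1) E y.  Computing
    u E x (2 W) by either formula gives 2 v W = v W + W, so v fixes W and with
    it (v + 1) E y, that is, v v E y = E y. *)
Lemma unit_pow4_mul_idem x y : x *m x = x -> x *m y = y -> y *m x = 0 ->
  u * u * (u * u * E y) = E y.
Proof.
move=> xx xy yx.
have dbl (w w' : A) : w + w = w' + w' -> w = w'.
  by move=> ww; rewrite -[w]half_double ww half_double.
have uXX : u * (E x * E x) = u * u * E x.
  by apply: dbl; rewrite unit_mul2 xx addrACA subrr addr0.
set W := u * (E x * E y).
have WW : W + W = u * u * E y + E y.
  by rewrite unit_mul2 xy yx raddf0 mulr0 subrr addr0.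
have uXW : u * E x * W = u * u * W.
  rewrite /W -mulrA [E x * _]mulrA -unit_central -mulrA [E x * (_ * _)]mulrA.
  by rewrite -!mulrA [E x * (_ * _)]mulrA 2![u * (_ * E y)]mulrA uXX !mulrA.
have uXuuY : u * E x * (u * u * E y + E y) = u * u * W + W.
  rewrite mulrDr /W !mulrA; congr (_ + _); congr (_ * _).
  by rewrite -2!mulrA [E x * (_ * _)]mulrA -sqr_unit_central !mulrA.
have vW : u * u * W = W.
  by apply: (addrI (u * u * W)); rewrite -uXuuY -WW mulrDr uXW.
have := congr1 ( *%R (u * u)) WW; rewrite !mulrDr vW WW addrC.
by move=> /addIr.
Qed.

(** The previous lemma covers E_ij with i != j, and E_ii is the triple product
    of (E_ij, E_jj, E_ji), whose outer factors are off the diagonal.  This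
    needs a second index: for n = 1 the triple relations are void. *)
Lemma unit_pow4_mul a : u * u * (u * u * E a) = E a.
Proof.
move: a; apply: delta_mx_ind => [|c a b ua ub|i j].
- by rewrite raddf0 !mulr0.
- by rewrite linearP !mulrDr -!scalerAr ua ub.
have off (p q : 'I_n) : p != q ->
    u * u * (u * u * E (delta_mx p q)) = E (delta_mx p q).
  move=> npq; apply: (@unit_pow4_mul_idem (delta_mx p p));
    rewrite ?mul_delta_mx //.
  by rewrite mul_delta_mx_0 // eq_sym.
have [<-{j}|/off//] := eqVneq i j.
have [j nij] : exists j, i != j.
  have [->|ni0] := eqVneq i (Ordinal (ltnW n_ge2)).
    by exists (Ordinal n_ge2).
  by exists (Ordinal (ltnW n_ge2)).
have nji : j != i by rewrite eq_sym.
have -> : delta_mx i i =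
    ajt_prod (delta_mx i j) (delta_mx j j) (delta_mx j i) :> 'M[F]_n.
  by rewrite /ajt_prod !mul_delta_mx mul_delta_mx_0 // mul0mx subr0.
have offM (p q : 'I_n) (w : A) : p != q ->
    u * u * (u * u * (E (delta_mx p q) * w)) = E (delta_mx p q) * w.
  by move=> npq; rewrite -[in RHS](off _ _ npq) !mulrA.
by rewrite -E_triple -[X in X - _]mulrA -[X in _ - X]mulrA !mulrBr !offM.
Qed.

(** * The straight and reversed parts *)

(** In a representation x |-> l x with l = 1, -1 this is x itself, and in
    x |-> l x^T with l = i, -i it vanishes. *)
Definition straight x : A := h *: (u * (u * u * E x + E x)).

(** Vanishes in x |-> l x with l = 1, -1; in x |-> l x^T with l = i, -i it is
    - x^T. *)
Definition reversed x : A := h *: (u * (E x - u * u * E x)).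

Lemma triple_repE x : E x = u * (straight x - reversed x).
Proof.
rewrite /straight /reversed -scalerBr -scalerAr -mulrBr opprB.
rewrite [X in _ * (_ * X)]addrACA subrr addr0 !mulrDr !mulrA.
by rewrite -!(mulrA (u * u)) unit_pow4_mul half_double.
Qed.

Lemma sqr_unit_straight x : u * (u * straight x) = straight x.
Proof.
rewrite /straight -!scalerAr; congr (h *: (u * _)).
by rewrite mulrA mulrDr unit_pow4_mul addrC.
Qed.

Lemma sqr_unit_reversed x : u * (u * reversed x) = - reversed x.
Proof.
rewrite /reversed -!scalerAr -scalerN -[in RHS]mulrN.
by congr (h *: (u * _)); rewrite mulrA mulrBr unit_pow4_mul opprB.
Qed.

(** The formula for 2 u E x E y, multiplied by u ^+ 3 and halved. *)
Lemma triple_rep_mul x y : E x * E y = straight (x *m y) + reversed (y *m x).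
Proof.
have uuuW : u * (u * u * (u * (E x * E y))) = E x * E y.
  by rewrite -[in RHS](unit_pow4_mul x) !mulrA.
rewrite /straight /reversed -scalerDr -mulrDr.
rewrite -[E x * E y]half_double -uuuW -2!mulrDr; congr (h *: (u * _)).
by rewrite unit_mul2 2!mulrDr mulrBr !unit_pow4_mul [_ + E (x *m y)]addrC.
Qed.

(** The factor 1 + v of [straight] doubles the straight part of E x E y and
    kills the reversed part; dually for [reversed] below. *)
Lemma straight_mul x y : straight x * E y = u * straight (x *m y).
Proof.
rewrite {1}/straight -scalerAl -!mulrA mulrDl -!mulrA triple_rep_mul.
rewrite [u * (straight _ + _)]mulrDr [u * (u * _ + u * _)]mulrDr.
rewrite sqr_unit_straight sqr_unit_reversed addrACA addNr addr0.
by rewrite mulrDr half_double.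
Qed.

Lemma reversed_mul x y : reversed x * E y = u * reversed (y *m x).
Proof.
rewrite {1}/reversed -scalerAl -!mulrA mulrBl -!mulrA triple_rep_mul.
rewrite [u * (straight _ + _)]mulrDr [u * (u * _ + u * _)]mulrDr.
rewrite sqr_unit_straight sqr_unit_reversed opprD opprK addrACA subrr add0r.
by rewrite mulrDr half_double.
Qed.

Lemma reversed0 : reversed 0 = 0.
Proof. by rewrite /reversed raddf0 mulr0 subrr mulr0 scaler0. Qed.

Lemma straight0 : straight 0 = 0.
Proof. by rewrite /straight raddf0 mulr0 addr0 mulr0 scaler0. Qed.

Lemma triple_rep_mul3 x y z :
  E x * E y * E z = u * (straight (x *m y *m z) + reversed (z *m y *m x)).
Proof.
by rewrite triple_rep_mul mulrDl straight_mul reversed_mul -mulrDr mulmxA.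
Qed.

Lemma triple_rep_mul4 x y z t :
  E x * E y * E z * E t =
  straight (x *m y *m z *m t) - reversed (t *m z *m y *m x).
Proof.
rewrite triple_rep_mul3 -mulrA mulrDl straight_mul reversed_mul -mulrDr.
by rewrite 2!mulrDr sqr_unit_straight sqr_unit_reversed !mulmxA.
Qed.

Lemma unit_reversed_mul x y : u * reversed x * E y = - reversed (y *m x).
Proof. by rewrite -mulrA reversed_mul sqr_unit_reversed. Qed.

End TripleRepresentation.

(** * From matrix units to matrices *)

Section TripleProductLinear.
Variables (F : fieldType) (n : nat).
Implicit Types (s : F) (a b c : 'M[F]_n).

Lemma ajt_prodPl s a a' b c :
  ajt_prod (s *: a + a') b c =
  s *: ajt_prod a b c + ajt_prod a' b c.
Proof.
rewrite /ajt_prod mulmxDr !mulmxDl -scalemxAr -!scalemxAl opprD addrACA.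
by rewrite -scalerBr.
Qed.

Lemma ajt_prodPm s a a' b c :
  ajt_prod b (s *: a + a') c =
  s *: ajt_prod b a c + ajt_prod b a' c.
Proof.
rewrite /ajt_prod !mulmxDr !mulmxDl -!scalemxAr -!scalemxAl opprD addrACA.
by rewrite -scalerBr.
Qed.

Lemma ajt_prodPr s a a' b c :
  ajt_prod b c (s *: a + a') =
  s *: ajt_prod b c a + ajt_prod b c a'.
Proof.
rewrite /ajt_prod mulmxDr !mulmxDl -scalemxAr -!scalemxAl opprD addrACA.
by rewrite -scalerBr.
Qed.

End TripleProductLinear.

Lemma triple_rep_delta (F : fieldType) (n : nat) (A : algType F)
    (E : {linear 'M[F]_n -> A}) :
  (forall i j k l m t,
    let a := delta_mx i j in let b := delta_mx k l in let c := delta_mx m t in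
    E a * E b * E c - E c * E b * E a = E (ajt_prod a b c)) ->
  forall a b c, E a * E b * E c - E c * E b * E a = E (ajt_prod a b c).
Proof.
move=> Ed a b c.
move: c; apply: delta_mx_ind => [|s c c' Hc Hc'|m t].
- by rewrite /ajt_prod !(mulmx0, mul0mx) subrr raddf0 mulr0 !mul0r subrr.
- rewrite ajt_prodPr !linearP mulrDr !mulrDl -scalerAr -!scalerAl opprD.
  by rewrite addrACA -scalerBr Hc Hc'.
move: a; apply: delta_mx_ind => [|s a a' Ha Ha'|i j].
- by rewrite /ajt_prod !(mulmx0, mul0mx) subrr raddf0 mulr0 !mul0r subrr.
- rewrite ajt_prodPl !linearP mulrDr !mulrDl -scalerAr -!scalerAl opprD.
  by rewrite addrACA -scalerBr Ha Ha'.
move: b; apply: delta_mx_ind => [|s b b' Hb Hb'|k l].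
- by rewrite /ajt_prod !(mulmx0, mul0mx) subrr raddf0 !(mulr0, mul0r) subrr.
- rewrite ajt_prodPm !linearP !mulrDr !mulrDl -!scalerAr -!scalerAl opprD.
  by rewrite addrACA -scalerBr Hb Hb'.
exact: Ed.
Qed.

Section SpanMatrix.
Variables (F : fieldType) (n : nat) (V : lmodType F) (e : 'I_n -> 'I_n -> V).

Definition span_mx (a : 'M[F]_n) : V := \sum_i \sum_j a i j *: e i j.

Fact span_mx_is_linear : linear span_mx.
Proof.
move=> c a b; rewrite /span_mx scaler_sumr -big_split; apply: eq_bigr => i _.
rewrite scaler_sumr -big_split; apply: eq_bigr => j _.
by rewrite /= !mxE scalerDl scalerA.
Qed.

HB.instance Definition _ :=
  GRing.isLinear.Build F 'M[F]_n V *:%R span_mx span_mx_is_linear.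

Lemma span_mx_delta i j : span_mx (delta_mx i j) = e i j.
Proof.
rewrite /span_mx (bigD1 i) //= (bigD1 j) //= mxE !eqxx scale1r.
rewrite !big1 ?addr0 // => [k /negPf ki|k /negPf kj].
  by rewrite big1 // => l _; rewrite mxE ki scale0r.
by rewrite mxE kj andbF scale0r.
Qed.

End SpanMatrix.

Lemma span_mx_triple (F : fieldType) (n : nat) (A : algType F)
    (e : 'I_n -> 'I_n -> A) :
  (forall i j k l m t,
    e i j * e k l * e m t - e m t * e k l * e i j =
    (kron F j k * kron F l m) *: e i t - (kron F t k * kron F l i) *: e m j) ->
  forall a b c : 'M[F]_n,
  span_mx e a * span_mx e b * span_mx e c
    - span_mx e c * span_mx e b * span_mx e a = span_mx e (ajt_prod a b c).
Proof.
move=> e_rel; apply: triple_rep_delta => i j k l m t /=.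
by rewrite ajt_prod_delta linearB !linearZ_LR /= !span_mx_delta scalerN e_rel.
Qed.

(** * Products of matrix-unit generators *)

(** The generators are kept as a separate family e, equal to E on matrix units,
    so that the results apply to any algebra in which they are given first. *)
Section TripleGenerators.
Variables (F : fieldType) (charF : [pchar F] =i pred0).
Variables (n : nat) (n_ge2 : (2 <= n)%N) (A : algType F).
Variables (E : {linear 'M[F]_n -> A}) (e : 'I_n -> 'I_n -> A).
Hypothesis E_triple : forall a b c,
  E a * E b * E c - E c * E b * E a = E (ajt_prod a b c).
Hypothesis E_delta : forall i j, E (delta_mx i j) = e i j.
Implicit Types (a b c t i j k l : 'I_n).

Local Notation d := (@kron F 'I_n).
Local Notation d' := (@kronC F 'I_n).
Local Notation o := (Ordinal (ltnW n_ge2)).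
Local Notation u := (E 1%:M).
Local Notation s a b := (straight E (delta_mx a b)).
Local Notation r a b := (reversed E (delta_mx a b)).
Local Notation half_double := (half_double charF).
Local Notation simp := (scale0r, scale1r, scaler0, mul0r, mulr0, mul1r, mulr1,
  add0r, addr0, subr0, subrr, sub0r, oppr0).

Lemma straight_deltaM a b c t :
  straight E (delta_mx a b *m delta_mx c t) = d b c *: s a t.
Proof.
rewrite mul_delta_mx_cond /kron; case: (b == c); first by rewrite scale1r.
by rewrite straight0 scale0r.
Qed.

Lemma reversed_deltaM a b c t :
  reversed E (delta_mx a b *m delta_mx c t) = d b c *: r a t.
Proof.
rewrite mul_delta_mx_cond /kron; case: (b == c); first by rewrite scale1r.
by rewrite reversed0 scale0r.
Qed.

Lemma genE a b : e a b = u * s a b - u * r a b.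
Proof. by rewrite -E_delta (triple_repE charF n_ge2 E_triple) mulrBr. Qed.

Lemma genM a b c t : e a b * e c t = d b c *: s a t + d t a *: r c b.
Proof.
rewrite -!E_delta (triple_rep_mul charF n_ge2 E_triple).
by rewrite straight_deltaM reversed_deltaM.
Qed.

Lemma straight_gen a b c t : s a b * e c t = u * (d b c *: s a t).
Proof.
by rewrite -E_delta (straight_mul charF n_ge2 E_triple) straight_deltaM.
Qed.

Lemma reversed_gen a b c t : r a b * e c t = u * (d t a *: r c b).
Proof.
by rewrite -E_delta (reversed_mul charF n_ge2 E_triple) reversed_deltaM.
Qed.

Lemma unit_reversed_gen a b c t : u * r a b * e c t = - (d t a *: r c b).
Proof.
by rewrite -E_delta (unit_reversed_mul charF n_ge2 E_triple) reversed_deltaM.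
Qed.

Lemma kron_diag a : d a a = 1.
Proof. by rewrite /kron eqxx. Qed.

Lemma gen_sqr a : e a a ^+ 2 = s a a + r a a.
Proof. by rewrite expr2 genM kron_diag !scale1r. Qed.

Lemma gen_cube a : e a a ^+ 3 = u * (s a a + r a a).
Proof.
rewrite exprSr expr2 -!E_delta (triple_rep_mul3 charF n_ge2 E_triple).
by rewrite !mul_delta_mx.
Qed.

Lemma gen_pow4 a : e a a ^+ 4 = s a a - r a a.
Proof.
rewrite 2!exprSr expr2 -!E_delta (triple_rep_mul4 charF n_ge2 E_triple).
by rewrite !mul_delta_mx.
Qed.

(** The straight part involves E_1k E_11 E_l1 = 0, so only the reversed product
    E_l1 E_11 E_1k = E_lk survives. *)
Lemma corner_word k l : l != o -> e o k * e o o * e l o = u * r l k.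
Proof.
move=> lo; rewrite -!E_delta (triple_rep_mul3 charF n_ge2 E_triple).
rewrite !mul_delta_mx -mulmxA mul_delta_mx_0; last by rewrite eq_sym.
by rewrite mulmx0 straight0 add0r.
Qed.

(** Both sides are - d j l *: r i k. *)
Lemma corner_word_gen i j k l : l != o ->
  e o k * e o o * e l o * e i j =
    d j l *: (2^-1 *: ((d k o * d' j o * d i o + d' i o * d i k) *: e o o ^+ 4
                       + (d' i o * d i k - d k o * d' j o * d i o)
                         *: e o o ^+ 2)
              - (d' i o * d k o) *: (e o o * e i o)
              - d' k o *: (e o k * e i o)).
Proof.
move=> lo.
rewrite corner_word // unit_reversed_gen gen_sqr gen_pow4 !genM kron_diag.
rewrite /kronC /kron.
have [->|jl] := eqVneq j l; last by rewrite !simp.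
rewrite (negPf lo) [k == i]eq_sym [o == i]eq_sym.
have [->|io] := eqVneq i o; have [->|ko] := eqVneq k o;
  rewrite ?eqxx ?(negPf io) ?(negPf ko) !simp //.
  by rewrite scaleN1r opprD addrACA subrr add0r half_double.
have [<-|_] := eqVneq i k; rewrite !simp //.
by rewrite addrACA addNr simp half_double opprD addrA subrr simp.
Qed.

(** Both sides are - d i l *: (u * r j k). *)
Lemma corner_word_row_col i j k l : l != o ->
  e o k * e o o * e l o * (e o i * e j o) =
    d i l *: (d k o *: ((d j o * 2^-1) *: (e o o - e o o ^+ 3)
                        - d' j o *: (e o o ^+ 2 * e j o))
              - d' k o *: (d' j o *: (e o k * e o o * e j o)
                           + d j o *: (e o o ^+ 2 * e o k - e o k))).
Proof.
move=> lo; rewrite (@corner_word k l) // mulrA unit_reversed_gen gen_sqr.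
rewrite gen_cube !mulNr -scalerAl reversed_gen -scalerN /kron.
have [_|//] := eqVneq i l; last by rewrite !scale0r.
rewrite !scale1r /kronC /kron.
have [->|jo] := eqVneq j o; have [->|ko] := eqVneq k o; rewrite !simp.
- rewrite genE -!mulrBr opprD addrACA subrr add0r mulrDr mulrN.
  by rewrite half_double.
- rewrite mulrDl straight_gen reversed_gen kron_diag /kron (negPf ko) !simp.
  by rewrite genE opprB addrAC subrr add0r.
- rewrite mulrDl straight_gen reversed_gen kron_diag /kron [o == j]eq_sym.
  by rewrite (negPf jo) !simp.
- by rewrite corner_word.
Qed.

(** Both sides are d j k *: r l i. *)
Lemma corner_word_corner_word i j k l : l != o -> j != o ->
  e o i * e o o * e j o * (e o k * e o o * e l o) =
    d j k *: (e o i * e l o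
              - (d' i o * d i l * 2^-1) *: (e o o ^+ 4 + e o o ^+ 2)).
Proof.
move=> lo jo; rewrite (@corner_word i j) // !mulrA unit_reversed_gen !mulNr.
rewrite -!(scalerAl (kron F k j)) reversed_gen kron_diag scale1r.
rewrite unit_reversed_gen kron_diag scale1r scalerN opprK gen_sqr gen_pow4 genM.
rewrite kron_diag !simp addrACA addNr simp /kronC /kron [k == j]eq_sym.
have [_|//] := eqVneq j k; last by rewrite !scale0r.
have [->|_] := eqVneq i l; last by rewrite !simp.
by rewrite (negPf lo) !simp half_double addrAC subrr add0r.
Qed.

(** The source of all the vanishing products: reversed, the factors meet in
    E_i1 E_lk = 0. *)
Lemma corner_word_col i k l : l != o -> e o k * e o o * e l o * e i o = 0.
Proof.
move=> lo; rewrite corner_word // unit_reversed_gen /kron eq_sym (negPf lo).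
by rewrite scale0r oppr0.
Qed.

Lemma corner_word_annihilates i j k l : l != o ->
  [/\ e o k * e o o * e l o * (e i o * e o j) = 0,
      e o k * e o o * e l o * (e o o ^+ 2 * e o j) = 0
    & e o k * e o o * e l o * e o o ^+ 4 = 0].
Proof.
move=> lo; have col0 := corner_word_col _ k lo.
split; first by rewrite mulrA col0 mul0r.
  by rewrite expr2 !mulrA col0 !mul0r.
by rewrite 3!exprS !mulrA col0 !mul0r.
Qed.

End TripleGenerators.

Theorem proposition4p7 (F : closedFieldType) (charF : [pchar F] =i pred0)
    (n : nat) (n_ge2 : (2 <= n)%N) :
  let o : 'I_n := Ordinal (ltnW n_ge2) in
  let e := @env_gen F n in
  let d := @kron F 'I_n in
  let d' := @kronC F 'I_n in
  forall i j k l : 'I_n, l != o ->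
  [/\ (* (1) *)
      e o k * e o o * e l o * e i j =
        d j l *: (2^-1 *: ((d k o * d' j o * d i o + d' i o * d i k) *: e o o ^+ 4
                           + (d' i o * d i k - d k o * d' j o * d i o) *: e o o ^+ 2)
                  - (d' i o * d k o) *: (e o o * e i o)
                  - d' k o *: (e o k * e i o)),
      (* (2) *)
      (i, j) != (o, o) ->
      e o k * e o o * e l o * (e o i * e j o) =
        d i l *: (d k o *: ((d j o * 2^-1) *: (e o o - e o o ^+ 3)
                            - d' j o *: (e o o ^+ 2 * e j o))
                  - d' k o *: (d' j o *: (e o k * e o o * e j o)
                               + d j o *: (e o o ^+ 2 * e o k - e o k))),
      (* (3) *)
      j != o ->
      e o i * e o o * e j o * (e o k * e o o * e l o) =
        d j k *: (e o i * e l o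
                  - (d' i o * d i l * 2^-1) *: (e o o ^+ 4 + e o o ^+ 2))
    & (* (4) *)
      [/\ e o k * e o o * e l o * (e i o * e o j) = 0,
          e o k * e o o * e l o * (e o o ^+ 2 * e o j) = 0
        & e o k * e o o * e l o * e o o ^+ 4 = 0]].
Proof.
move=> o e d d' i j k l lo.
have e_triple := span_mx_triple (@env_gen_rel F n).
have e_delta := span_mx_delta e.
split=> [|_|jo|].
- exact: (corner_word_gen charF e_triple e_delta).
- exact: (corner_word_row_col charF e_triple e_delta).
- exact: (corner_word_corner_word charF e_triple e_delta).
- exact: (corner_word_annihilates charF e_triple e_delta).
Qed.
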